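(* Let $m>3$ be an integer and let $S=\{(1,1,1,0,\ldots,0),(0,1,1,0,\ldots,0),(1,1,0,0,\ldots,0)\}\subseteq\mathbb{Z}_2^m$. Let $a,b\in\mathbb{Z}_2^m$ with $b-a=(1,\ldots,1)$. Then the complement of $\mathrm{Cay}(\mathbb{Z}_2^m,S)$ does not exhibit PGFR between $a$ and $b$.
   Context: For a finite abelian group $G$ (written additively) and $S\subseteq G\setminus\{0\}$ with $S=-S$, the Cayley graph $\mathrm{Cay}(G,S)$ has vertex set $G$, two distinct vertices $a,b$ being adjacent iff $b-a\in S$; its complement is $\mathrm{Cay}(G,G\setminus(S\cup\{0\}))$. For a graph $\Gamma$ with adjacency matrix $A$, the transition matrix is $H(t)=\exp(-\mathbf{i}tA)$, $t\in\mathbb{R}$, and $\mathbf{e}_v$ is the standard basis vector of vertex $v$. $\Gamma$ exhibits pretty good fractional revival (PGFR) between distinct vertices $a$ and $b$ if there is a sequence of real numbers $\{t_k\}$ with $\lim_{k\to\infty}H(t_k)\mathbf{e}_a=\alpha\mathbf{e}_a+\beta\mathbf{e}_b$ for some $\alpha,\beta\in\mathbb{C}$ with $\beta\neq0$ and $|\alpha|^2+|\beta|^2=1$. *)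

(* Defs.v *)
From HB Require Import structures.
From mathcomp Require Import all_boot all_order all_algebra.
From mathcomp Require Import complex.
From mathcomp Require Import boolp classical_sets reals topology normedtype.
From mathcomp Require Import sequences.

Set Implicit Arguments.
Unset Strict Implicit.
Unset Printing Implicit Defensive.

Import Order.TTheory GRing.Theory Num.Theory.
Import numFieldNormedType.Exports.

Local Open Scope classical_set_scope.
Local Open Scope ring_scope.

(* The field R[i], packaged as a numClosedFieldType so that it inherits the
   norm topology that the library puts on every such field. *)
Definition Cplx (R : realType) : numClosedFieldType := R[i].

Definition of_real (R : realType) (x : R) : Cplx R := real_complex R x.

(* A simple graph on T is given by a symmetric irreflexive adjacency relation. *)
Definition cayley (G : finZmodType) (S : {set G}) : rel G :=
  fun a b => (a != b) && (b - a \in S).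

Definition graph_compl (T : finType) (e : rel T) : rel T :=
  fun a b => (a != b) && ~~ e a b.

Lemma cayley_irr (G : finZmodType) (S : {set G}) : irreflexive (cayley S).
Proof. by move=> a; rewrite /cayley eqxx. Qed.

Lemma cayley_sym (G : finZmodType) (S : {set G}) :
  (forall x, x \in S -> - x \in S) -> symmetric (cayley S).
Proof.
move=> SN a b; rewrite /cayley eq_sym; congr andb.
by apply/idP/idP => /SN; rewrite opprB.
Qed.

Lemma graph_compl_cayley (G : finZmodType) (S : {set G}) :
  graph_compl (cayley S) =2 cayley (~: (0 |: S)).
Proof.
move=> a b; rewrite /graph_compl /cayley !inE subr_eq0 [b == a]eq_sym.
by case: (a == b).
Qed.

Definition adj_mx (R : realType) (T : finType) (e : rel T) :
    'M[Cplx R]_#|T| :=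
  \matrix_(i, j) (e (enum_val i) (enum_val j))%:R.

Definition expmx (R : realType) (n : nat) (A : 'M[Cplx R]_n) : 'M[Cplx R]_n :=
  limn (fun N : nat => \sum_(k < N) (k`!%:R)^-1 *: A ^+ k).

Definition transition_mx (R : realType) (T : finType) (e : rel T) (t : R) :
    'M[Cplx R]_#|T| :=
  expmx (- ('i * of_real t) *: adj_mx R e).

Definition vertex_vec (R : realType) (T : finType) (v : T) : 'cV[Cplx R]_#|T| :=
  delta_mx (enum_rank v) 0.

Definition PGFR (R : realType) (T : finType) (e : rel T) (a b : T) : Prop :=
  a != b /\
  exists (t : nat -> R) (alpha beta : Cplx R),
    [/\ (fun k : nat => transition_mx e (t k) *m vertex_vec R a) @ \oo
          --> alpha *: vertex_vec R a + beta *: vertex_vec R b,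
        beta != 0 &
        `|alpha| ^+ 2 + `|beta| ^+ 2 = 1].

(* The vector of Z_2^m whose first coordinates are listed in s, padded with
   zeros. *)
Definition pad_row (m : nat) (s : seq 'Z_2) : 'rV['Z_2]_m := \row_j s`_j.

(* Main.v *)
(** A graph automorphism commutes with the transition matrix [H(t)], so if it
    fixes [a] and moves [b] to some [c <> b], then [H(t)_{b,a} = H(t)_{c,a}] for
    all [t]; in the limit [beta = 0]. All connection vectors vanish in the
    fourth coordinate, so adding a vector with this property to exactly those
    vertices whose fourth coordinate differs from that of [a] is such an
    automorphism of the Cayley graph and of its complement. *)

Require Import Defs.
From mathcomp Require Import all_boot all_order all_algebra.
From mathcomp Require Import boolp classical_sets reals topology normedtype.

Import GRing.Theory.
Import numFieldNormedType.Exports.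
Local Open Scope ring_scope.

(** An injection of the finite set ['I_n] is a permutation, so it reindexes the sum in a matrix
    product. *)
Lemma exprmx_invariant {R : pzRingType} {n : nat} {A : 'M[R]_n}
    {s : 'I_n -> 'I_n} (s_inj : injective s)
    (sA : forall i j, A (s i) (s j) = A i j) (k : nat) (i j : 'I_n) :
  (A ^+ k) (s i) (s j) = (A ^+ k) i j.
Proof.
elim: k i j => [|k IHk] i j; first by rewrite !expr0 !mxE (inj_eq s_inj).
rewrite !exprS !mxE (reindex_inj s_inj) /=.
by apply: eq_bigr => l _; rewrite sA IHk.
Qed.

(** Invariance passes from the partial sums to the limit because taking an entry is continuous;
    splitting on convergence avoids proving that the series converges. *)
Lemma expmx_invariant {R : realType} {n : nat} {A : 'M[Cplx R]_n}
    {s : 'I_n -> 'I_n} (s_inj : injective s)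
    (sA : forall i j, A (s i) (s j) = A i j) (i j : 'I_n) :
  expmx A (s i) (s j) = expmx A i j.
Proof.
rewrite /expmx; set P := fun N => _.
have [cvP|dvP] := pselect (cvgn P); last first.
  (* The junk value of a divergent limit is a constant matrix. *)
  by rewrite (dvgP dvP) !mxE.
have cvE i' j' : ((fun N => P N i' j') @ \oo --> (limn P : 'M[Cplx R]_n) i' j')%classic.
  exact: (continuous_cvg _ (@coord_continuous _ _ _ _ _ _) cvP).
have Ps : (fun N => P N (s i) (s j)) = (fun N => P N i j).
  apply: funext => N; rewrite /P !summxE.
  by apply: eq_bigr => k _; rewrite !mxE exprmx_invariant.
have := cvE (s i) (s j); rewrite Ps => cvs.
exact: (cvg_unique (@norm_hausdorff _ _) cvs (cvE i j)).
Qed.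

Lemma transition_mx_invariant {R : realType} {T : finType} {e : rel T}
    {f : T -> T} (f_inj : injective f) (fe : forall x y, e (f x) (f y) = e x y)
    (t : R) (x y : T) :
  transition_mx e t (enum_rank (f x)) (enum_rank (f y)) =
  transition_mx e t (enum_rank x) (enum_rank y).
Proof.
pose s (i : 'I_#|T|) := enum_rank (f (enum_val i)).
have s_inj : injective s by move=> i j /enum_rank_inj/f_inj/enum_val_inj.
have sE z : enum_rank (f z) = s (enum_rank z) by rewrite /s enum_rankK.
rewrite !sE; apply: expmx_invariant => // i j.
by rewrite !mxE !enum_rankK fe.
Qed.

Lemma PGFR_fixed {R : realType} {T : finType} {e : rel T} {a b : T}
    {f : T -> T} (f_inj : injective f) (fe : forall x y, e (f x) (f y) = e x y) :
  PGFR R e a b -> f a = a -> f b = b.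
Proof.
move=> [neq_ab [t [alpha [beta [cvH beta_neq0 _]]]]] fa.
have [//|neq_fb] := eqVneq (f b) b.
have cvE x :
    ((fun k => transition_mx e (t k) (enum_rank x) (enum_rank a)) @ \oo
      --> alpha * (x == a)%:R + beta * (x == b)%:R)%classic.
  have -> : (fun k => transition_mx e (t k) (enum_rank x) (enum_rank a)) =
      (fun k => (transition_mx e (t k) *m vertex_vec R a) (enum_rank x) 0).
    by apply: funext => k; rewrite /vertex_vec -colE mxE.
  have := continuous_cvg _ (@coord_continuous _ _ _ (enum_rank x) 0 _) cvH.
  by rewrite !mxE !(inj_eq enum_rank_inj) !andbT; apply.
have cvb := cvE b; have := cvE (f b).
(* Since [f a = a], the entry at [(f b, a)] is the one at [(f b, f a)]. *)
have -> : (fun k => transition_mx e (t k) (enum_rank (f b)) (enum_rank a)) =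
    (fun k => transition_mx e (t k) (enum_rank b) (enum_rank a)).
  by apply: funext => k; rewrite -{1}fa transition_mx_invariant.
move=> cvfb; have := cvg_unique (@norm_hausdorff _ _) cvfb cvb.
move=> /(_ _)/eqP.
(* The limit at [b] is [beta], but at [f b] it is [0]: injectivity and [f a = a] give [f b != a]. *)
rewrite -{1}fa (inj_eq f_inj) [b == a]eq_sym (negPf neq_ab) (negPf neq_fb).
by rewrite eqxx !mulr0 !add0r mulr1 eq_sym (negPf beta_neq0).
Qed.

Theorem theorem5p5 (R : realType) (m : nat) (hm : (3 < m)%N)
    (a b : 'rV['Z_2]_m) (hab : b - a = const_mx 1) :
  let S : {set 'rV['Z_2]_m} :=
    [set pad_row m [:: 1; 1; 1]; pad_row m [:: 0; 1; 1];
         pad_row m [:: 1; 1]] in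
  ~ PGFR R (graph_compl (cayley S)) a b.
Proof.
(* [l] is the fourth coordinate, counted from 0; [d], the first unit vector, is nonzero but vanishes
   there. *)
move=> S hP; pose l := Ordinal hm; pose d : 'rV['Z_2]_m := pad_row m [:: 1].
have dl : d 0 l = 0 by rewrite mxE.
have Sl x : x \in S -> x 0 l = 0.
  by rewrite !inE -orbA => /or3P[] /eqP ->; rewrite mxE.
pose f (x : 'rV['Z_2]_m) := if x 0 l == a 0 l then x else x + d.
have fl x : f x 0 l = x 0 l by rewrite /f; case: ifP; rewrite // mxE dl addr0.
have f_inj : injective f.
  move=> x y fxy; have := fl x; rewrite fxy fl => xyl.
  by move: fxy; rewrite /f -xyl; case: ifP => // _ /addIr.
have fe x y :
    graph_compl (cayley S) (f x) (f y) = graph_compl (cayley S) x y.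
  rewrite /graph_compl /cayley (inj_eq f_inj); congr (_ && ~~ (_ && _)).
  have [xyl|xyl] := eqVneq (x 0 l) (y 0 l).
    rewrite /f xyl; case: ifP => // _.
    by rewrite opprD addrACA subrr addr0.
  (* Vertices that differ at [l] are not adjacent in the Cayley graph, and [f] keeps them different
     at [l]. *)
  have notS (z w : 'rV['Z_2]_m) : z 0 l != w 0 l -> (w - z \in S) = false.
    apply: contra_neqF => /Sl; rewrite !mxE => /eqP.
    by rewrite subr_eq0 => /eqP.
  by rewrite !notS // !fl.
have fa : f a = a by rewrite /f eqxx.
have := PGFR_fixed f_inj fe hP fa; rewrite /f.
(* As [b] and [a] differ at [l], [f b = b] reads [b + d = b], which the first coordinate of [d]
   refutes. *)
have -> : (b 0 l == a 0 l) = false.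
  have: (b - a) 0 l = 1 by rewrite hab mxE.
  by rewrite !mxE -subr_eq0 => ->.
rewrite -[RHS]addr0 => /addrI d0.
have: d 0 (Ordinal (ltn_trans (isT : (0 < 3)%N) hm)) = 0 by rewrite d0 mxE.
by rewrite mxE.
Qed.
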